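(* Let $\kappa,\gamma,a_1,a_2>0$ be real numbers. For the relay feedback system whose plant has transfer function $\dfrac{\kappa s+\gamma}{s^2+a_1s+a_2}$, all trajectories converge asymptotically to the chattering set $$\{(x_1,x_2)\in\mathbb{R}^2:\ x_1\in[-\kappa,\kappa],\ x_2=0\},$$ which is bounded and of measure zero; that is, the distance from $x(t)$ to this set tends to $0$ as $t\to\infty$.
   Context: The plant is realized in state space by $\dot x=Ax+Bu$, $y=Cx$, $x=(x_1,x_2)^T\in\mathbb{R}^2$, with $$A=\begin{bmatrix}0&-a_2\\1&-a_1\end{bmatrix},\quad B=\begin{bmatrix}\gamma\\\kappa\end{bmatrix},\quad C=\begin{bmatrix}0&1\end{bmatrix}.$$ The relay feedback system is the negative feedback loop $u=-\operatorname{sign}(y)$ with an ideal on-off relay (no hysteresis). A trajectory is a solution on $[0,\infty)$ in the sense of Filippov: an absolutely continuous function $x:[0,\infty)\to\mathbb{R}^2$ satisfying, for almost every $t$, the inclusion $\dot x\in\{Ax-B\}$ if $Cx>0$, $\dot x\in\{Ax+\lambda B:\lambda\in[-1,1]\}$ if $Cx=0$, and $\dot x\in\{Ax+B\}$ if $Cx<0$. *)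

(* Defs.v *)
From HB Require Import structures.
From mathcomp Require Import all_boot all_order all_algebra.
From mathcomp Require Import all_classical all_reals all_analysis.

Set Implicit Arguments.
Unset Strict Implicit.
Unset Printing Implicit Defensive.

Import Order.TTheory GRing.Theory Num.Theory.
Import numFieldNormedType.Exports.

Local Open Scope classical_set_scope.
Local Open Scope ring_scope.

Definition absolutely_continuous_on (R : realType) (V : normedModType R)
    (a b : R) (f : R -> V) : Prop :=
  forall e : R, 0 < e -> exists2 d : R, 0 < d &
    forall (m : nat) (l r : 'I_m -> R),
      (forall i, a <= l i /\ l i < r i /\ r i <= b) ->
      trivIset [set: 'I_m] (fun i => [set` `]l i, r i[%R]) ->
      \sum_(i < m) (r i - l i) < d ->
      \sum_(i < m) `|f (r i) - f (l i)| < e.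

(* Right-hand side of the differential inclusion for u = - sign y. *)
Definition relay_filippov (R : realType) (n : nat)
    (A : 'M[R]_n) (B : 'cV[R]_n) (C : 'rV[R]_n) (x : 'cV[R]_n)
    : set 'cV[R]_n :=
  let y := (C *m x) 0 0 in
  if 0 < y then [set A *m x - B]
  else if y < 0 then [set A *m x + B]
  else [set A *m x + l *: B | l in [set` `[-1, 1]%R]].

(* Only the values of x on [0, +oo[ matter: the two-sided derivative is
   required at almost every t >= 0, and {0} is a null set.  Absolute
   continuity on the unbounded interval is meant on each compact subinterval. *)
Definition filippov_solution (R : realType) (n : nat)
    (F : 'cV[R]_n -> set 'cV[R]_n) (x : R -> 'cV[R]_n) : Prop :=
  (forall T : R, 0 < T -> absolutely_continuous_on 0 T x) /\
  {ae lebesgue_measure, forall t : R, 0 <= t ->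
     exists2 v : 'cV[R]_n, F (x t) v & is_derive t 1 x v}.

Definition relay_trajectory (R : realType) (n : nat)
    (A : 'M[R]_n) (B : 'cV[R]_n) (C : 'rV[R]_n) (x : R -> 'cV[R]_n) : Prop :=
  filippov_solution (relay_filippov A B C) x.

Definition vec2 (R : realType) (u v : R) : 'cV[R]_2 :=
  \col_(i < 2) nth 0 [:: u; v] i.

Definition plantA (R : realType) (a1 a2 : R) : 'M[R]_2 :=
  \matrix_(i < 2, j < 2)
    nth 0 (nth [::] [:: [:: 0; - a2]; [:: 1; - a1]] i) j.

Definition plantB (R : realType) (kappa gamma : R) : 'cV[R]_2 :=
  vec2 gamma kappa.

Definition plantC (R : realType) : 'rV[R]_2 :=
  \row_(j < 2) nth 0 [:: 0; 1] j.

(* C (s I - A)^-1 B over the field of rational functions in s. *)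
Definition transfer_function (R : realType) (n : nat)
    (A : 'M[R]_n) (B : 'cV[R]_n) (C : 'rV[R]_n) : {fraction {poly R}} :=
  let toF := @FracField.tofrac {poly R} in
  (map_mx (toF \o polyC) C *m invmx (map_mx toF (char_poly_mx A))
     *m map_mx (toF \o polyC) B) 0 0.

Definition chattering_set (R : realType) (kappa : R) : set 'cV[R]_2 :=
  [set x | - kappa <= x 0 0 <= kappa /\ x 1 0 = 0].

(* The library norm on matrices is the sup norm, hence this definition. *)
Definition euclidean_norm (R : realType) (n : nat) (v : 'cV[R]_n) : R :=
  Num.sqrt (\sum_(i < n) v i 0 ^+ 2).

Definition distance_to (R : realType) (n : nat) (S : set 'cV[R]_n)
    (x : 'cV[R]_n) : R :=
  inf [set euclidean_norm (x - y) | y in S].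

Definition null_set2 (R : realType) (S : set 'cV[R]_2) : Prop :=
  (@lebesgue_measure R \x @lebesgue_measure R)%E.-negligible
    [set p : R * R | S (vec2 p.1 p.2)].

Local Notation toF := (@FracField.tofrac _).

Lemma plant_transfer_function (R : realType) (kappa gamma a1 a2 : R) :
  transfer_function (plantA a1 a2) (plantB kappa gamma) (plantC R) =
  toF (kappa *: 'X + gamma%:P) / toF ('X^2 + a1 *: 'X + a2%:P).
Proof.
rewrite /transfer_function /=.
set P := map_mx _ (char_poly_mx _); set d := 'X^2 + a1 *: 'X + a2%:P.
have d_neq0 : toF d != 0.
  rewrite tofrac_eq0; apply/eqP => /(congr1 (fun p : {poly R} => p`_2)).
  rewrite !coefD coefXn coefZ coefX coefC coef0 /= mulr0 !addr0.
  by apply/eqP; rewrite oner_eq0.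
have P00 : P 0 0 = toF 'X by rewrite !mxE /= subr0.
have P01 : P 0 1 = toF a2%:P by rewrite !mxE /= polyCN sub0r opprK.
have P10 : P 1 0 = - toF 1 by rewrite !mxE /= sub0r rmorphN.
have P11 : P 1 1 = toF ('X + a1%:P) by rewrite !mxE /= polyCN opprK.
clearbody P.
have dE : toF 'X * toF ('X + a1%:P) + toF a2%:P = toF d.
  by rewrite -rmorphM -rmorphD mulrDr -expr2 (mulrC 'X) mul_polyC.
have Punit : P \in unitmx.
  rewrite unitmxE unitfE (expand_det_row _ 0) big_ord_recl big_ord1.
  rewrite /cofactor !det_mx11 !mxE.
  have -> : lift ord0 ord0 = 1 :> 'I_2 by apply/val_inj.
  have -> : lift 1 0 = 0 :> 'I_2 by apply/val_inj.
  rewrite P00 P01 P10 P11 /= expr0 mul1r expr1 mulN1r opprK.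
  by rewrite rmorph1 mulr1 dE.
pose w : 'rV_2 := (toF d)^-1 *: \row_(j < 2) nth 0 [:: 1; toF 'X] j.
have wP : map_mx (toF \o polyC) (plantC R) = w *m P.
  apply/rowP => j; rewrite -scalemxAl !mxE big_ord_recl big_ord1.
  have -> : lift ord0 ord0 = 1 :> 'I_2 by apply/val_inj.
  case: (unliftP 0 j) => [k ->|->].
    rewrite ord1; have -> : lift 0 0 = 1 :> 'I_2 by apply/val_inj.
    by rewrite P01 P11 !mxE /= mul1r addrC dE mulVf // !rmorph1.
  by rewrite P00 P10 !mxE /= mul1r !rmorph1 mulrN1 subrr mulr0 !rmorph0.
rewrite wP mulmxK // -scalemxAl mxE mulrC; congr (_ / _).
rewrite mxE big_ord_recl big_ord1 !mxE /= mul1r -rmorphM -rmorphD.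
by rewrite addrC (mulrC 'X) mul_polyC.
Qed.

(* Main.v *)
(** Along a trajectory, the energy V = x1^2/2 + a2 x2^2/2 + gamma |x2| satisfies
    V' = - a1 a2 x2^2 - (a2 kappa + gamma a1) |x2| - gamma kappa where x2 <> 0.
    The zeros of x2 with x2' <> 0 are isolated, hence negligible; at the other
    zeros the equation for x2' forces u = - x1 / kappa, hence
    V' = - (2 gamma / kappa) V.  So almost everywhere
    V' <= - min (gamma kappa) ((2 gamma / kappa) V), and V tends to 0: the
    trajectory even converges to the origin, a point of the chattering set. *)
Require Import Defs.
From mathcomp Require Import all_boot all_order all_algebra.
From mathcomp Require Import all_classical all_reals all_analysis.
From mathcomp Require Import measurable_realfun ring lra.
Import Order.TTheory GRing.Theory Num.Theory.
Import numFieldNormedType.Exports.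
Local Open Scope classical_set_scope.
Local Open Scope ring_scope.

(** * Monotonicity of absolutely continuous functions from almost everywhere derivative bounds *)

(** Cutting the increment at [t] leaves two difference quotients based at [t], both below [k] near
    [t]. The points must lie on either side of [t]: the derivative at [t] alone does not control
    increments on one side. *)
Lemma is_derive_straddle (R : realType) (f : R -> R) (t v k : R) :
  is_derive t 1 f v -> v < k ->
  exists2 d : R, 0 < d & forall l r : R, t - d < l -> l <= t -> t <= r ->
    r < t + d -> f r - f l <= k * (r - l).
Proof.
move=> /is_derive1_caratheodory[q [fq cq qt]] vk.
have qv : q z @[z --> t] --> v by rewrite -qt; exact: cq.
have : \forall z \near t, q z < k by exact: cvgr_lt qv _ vk.
move=> /nbhs_ballP[d /= d0 qk]; exists d => // l r dl lt tr rd.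
have ql : q l <= k by apply/ltW/qk; rewrite /ball/= ltr_norml; lra.
have qr : q r <= k by apply/ltW/qk; rewrite /ball/= ltr_norml; lra.
have -> : f r - f l = (f r - f t) - (f l - f t) by lra.
rewrite !fq.
have : q r * (r - t) <= k * (r - t) by rewrite ler_wpM2r//; lra.
have : q l * (t - l) <= k * (t - l) by rewrite ler_wpM2r//; lra.
lra.
Qed.

Lemma sum_disjoint_itv_le (R : realType) (U : set R) (m : nat)
    (l r : 'I_m -> R) :
  measurable U -> (forall i, l i < r i) ->
  trivIset [set: 'I_m] (fun i => [set` `]l i, r i[%R]) ->
  (forall i, [set` `]l i, r i[%R] `<=` U) ->
  ((\sum_(i < m) (r i - l i))%:E <= lebesgue_measure U)%E.
Proof.
move=> mU lr triv sub.
have -> : ((\sum_(i < m) (r i - l i))%:E =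
    lebesgue_measure (\big[setU/set0]_(i < m) [set` `]l i, r i[%R]))%E.
  rewrite measure_bigsetU_ord//= -sumEFin; apply: eq_bigr => i _.
  by rewrite lebesgue_measure_itv/= lte_fin lr EFinB.
apply: le_measure; rewrite ?inE//.
  by apply: bigsetU_measurable => i _ /=; exact: measurable_itv.
by elim/big_ind: _ => // A B AU BU; rewrite subUset.
Qed.

(** Outer regularity applies to the measurable null set [A] containing [N]; as [A] has measure zero,
    [U] weighs no more than [U] minus [A]. *)
Lemma open_cover_null (R : realType) (N : set R) (e : R) :
  lebesgue_measure.-negligible N -> 0 < e ->
  exists U : set R, [/\ open U, N `<=` U & (lebesgue_measure U < e%:E)%E].
Proof.
move=> [A [mA A0 NA]] e0.
have [|U [oU AU UAe]] := lebesgue_regularity_outer mA _ e0.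
  by rewrite [ltLHS]A0 ltry.
exists U; split => //; first exact: subset_trans AU.
have mU : measurable U by exact: open_measurable.
apply: le_lt_trans UAe.
rewrite -[U in leLHS](setDUK AU) (le_trans (measureU2 _ _ _))//.
  exact: measurableD.
by rewrite [X in (X + _)%E]A0 add0e.
Qed.

Lemma absolutely_continuous_on_sub (R : realType) (V : normedModType R)
    (a b c d : R) (f : R -> V) : a <= c -> d <= b ->
  absolutely_continuous_on a b f -> absolutely_continuous_on c d f.
Proof.
move=> ac db fac e /fac[h h0 fh]; exists h => // m l r lr; apply: fh => i.
by have [cl [lri rd]] := lr i; split; [lra|split => //; lra].
Qed.

(** The family [oapp l c (unlift ord_max i)] is [l] with [c] appended at the last index; it serves
    to add one interval to a finite disjoint family. *)
Lemma big_ord_unlift_max (R : realType) (T : Type) (n : nat) (l : 'I_n -> T)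
    (c : T) (F : T -> R) :
  \sum_(i < n.+1) F (oapp l c (unlift ord_max i)) =
  \sum_(i < n) F (l i) + F c.
Proof.
rewrite big_ord_recr/= unlift_none/=; congr (_ + _); apply: eq_bigr => i _.
have -> : widen_ord (leqnSn n) i = lift ord_max i.
  by apply/val_inj; rewrite /= /bump leqNgt ltn_ord.
by rewrite liftK.
Qed.

(* Real induction on the right endpoint [c]: an interval around a point of the
   null set joins a disjoint family inside a small open cover [U], whose total
   variation is controlled by absolute continuity; an interval around any other
   point is controlled by the derivative there. *)
Lemma abs_cont_ae_derive_le (R : realType) (f : R -> R) (a b k : R) :
  a <= b -> absolutely_continuous_on a b f ->
  {ae lebesgue_measure, forall t : R, a <= t <= b ->
    exists2 v : R, v <= k & is_derive t 1 f v} ->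
  f b - f a <= k * (b - a).
Proof.
move=> ab fac fae; apply/ler_addgt0Pr => /= e; rewrite -[e]/(e : R) => e0.
(* The error [e] is split in three: the slope excess [e1] over [[a, b]], the variation of [f] on the
   collected intervals, and [k1] times their total length. The [+ 1] keeps the denominator positive
   when [a = b]. *)
pose e1 : R := e / 3 / (b - a + 1).
have ba1 : 0 < b - a + 1 by lra.
have e10 : 0 < e1 by rewrite /e1 !divr_gt0.
have [|d d0 fd] := fac (e / 3); first by rewrite divr_gt0.
(* When [k] is negative, [(k + e1) * (c - a)] may decrease as [c] crosses a collected interval; as
   [k1 >= - k], adding [k1] times the length of that interval compensates. *)
pose k1 : R := `|k| + 1.
have k10 : 0 < k1 by rewrite /k1 ltr_wpDl.
have kk1 : - k <= k1 by rewrite /k1 -normrN ler_wpDr// ler_norm.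
pose d1 : R := Num.min d (e / 3 / k1).
have [|U [oU NU Ud]] := @open_cover_null R _ d1 fae.
  by rewrite lt_min d0 !divr_gt0.
(* Invariant of the induction: up to [c], [f] grows with slope at most [k + e1], except for a
   correction paid on finitely many disjoint intervals inside [U]. *)
pose P (c : R) := a <= c <= b /\ exists (m : nat) (lr : 'I_m -> R * R),
  [/\ forall i, a <= (lr i).1 /\ (lr i).1 < (lr i).2 /\ (lr i).2 <= c,
      trivIset [set: 'I_m] (fun i => [set` `](lr i).1, (lr i).2[%R]),
      forall i, [set` `](lr i).1, (lr i).2[%R] `<=` U &
      f c - f a <= (k + e1) * (c - a) +
        \sum_(i < m) (`|f (lr i).2 - f (lr i).1| + k1 * ((lr i).2 - (lr i).1))].
have Pext1 c c' : P c -> c <= c' <= b -> f c' - f c <= (k + e1) * (c' - c) ->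
    P c'.
  move=> [acb [m [lr [lrc tr lrU fc]]]] cc' ff; split; first lra.
  exists m, lr; split => //; last lra.
  by move=> i; have [? [? ?]] := lrc i; split => //; split => //; lra.
have Pext2 c c' : P c -> c < c' <= b -> [set` `]c, c'[%R] `<=` U -> P c'.
  move=> [acb [m [lr [lrc tr lrU fc]]]] cc' cU; split; first lra.
  exists m.+1, (fun i => oapp lr (c, c') (unlift ord_max i)); split.
  - move=> i; case: unliftP => [j _|_] /=; last by split; lra.
    by have [? [? ?]] := lrc j; split => //; split => //; lra.
  - move=> i j _ _.
    case: (unliftP ord_max i) => [i' ->|->];
      case: (unliftP ord_max j) => [j' ->|->] //=.
    + by move=> /(tr i' j' I I) ->.
    + case=> x [/=]; rewrite !in_itv/= => ? ?.
      by have [_ [_ ?]] := lrc i'; exfalso; lra.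
    + case=> x [/=]; rewrite !in_itv/= => ? ?.
      by have [_ [_ ?]] := lrc j'; exfalso; lra.
  - by move=> i; case: unliftP => [j _|_] /=; [exact: lrU|exact: cU].
  - rewrite (big_ord_unlift_max R _ m lr (c, c')
      (fun p => `|f p.2 - f p.1| + k1 * (p.2 - p.1)))/=.
    have := ler_norm (f c' - f c).
    have : 0 <= (k + e1 + k1) * (c' - c) by rewrite mulr_ge0//; lra.
    lra.
have Pa : P a.
  split; first lra.
  exists 0%N, (fun=> (0, 0)); split; [by case|by case|by case|].
  by rewrite big_ord0; lra.
pose c : R := sup P.
have supP : has_sup P by split; [exists a|exists b => x [/andP[]]].
have acb : a <= c <= b.
  rewrite (ub_le_sup supP.2 Pa)/= ge_sup//; first by exists a.
  by move=> x [/andP[]].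
(* The supremum [c] is not yet known to satisfy [P], so the step must start from any [p] just left
   of [c] and jump over [c] to [q]. *)
have [r r0 Pr] : exists2 r, 0 < r & forall p q : R,
    P p -> c - r < p -> p <= c -> c <= q -> q <= b -> q < c + r -> P q.
  have [[v vk df]|cN] := pselect (exists2 v : R, v <= k & is_derive c 1 f v).
    have [|r r0 fr] := @is_derive_straddle _ _ _ _ (k + e1) df; first lra.
    exists r => // p q Pp rp pc cq qb qr; apply: Pext1 Pp _ _; first lra.
    by apply: fr => //; lra.
  have /NU : ~ (a <= c <= b -> exists2 v : R, v <= k & is_derive c 1 f v).
    by move=> /(_ acb).
  move=> Uc; have /nbhs_ballP[r /= r0 rU] : nbhs c U by exact: open_nbhs_nbhs.
  exists r => //.
  move=> p q Pp rp pc cq qb qr.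
  have [pq|pq] := ltP p q; last by have -> : q = p by lra.
  apply: Pext2 Pp _ _; first lra.
  move=> x /=; rewrite in_itv/= => pxq; apply: rU.
  by rewrite /ball/= ltr_norml; lra.
have [p Pp rp] := sup_adherent r0 supP.
have pc : p <= c by exact: (ub_le_sup supP.2 Pp).
(* If [b] were out of reach, [P (c + r / 2)] would contradict the choice of [c] as supremum. *)
have Pb : P b.
  have [qb|qb] := leP b (c + r / 2).
    by apply: Pr Pp rp pc _ _ _ => //; lra.
  have : P (c + r / 2) by apply: Pr Pp rp pc _ _ _; lra.
  by move=> /(ub_le_sup supP.2); rewrite -/c; lra.
have [_ [m [lr [lrb tr lrU fb]]]] := Pb.
have lrd1 : \sum_(i < m) ((lr i).2 - (lr i).1) < d1.
  rewrite -lte_fin; apply: le_lt_trans Ud; apply: sum_disjoint_itv_le => //.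
    exact: open_measurable.
  by move=> i; have [_ []] := lrb i.
have : \sum_(i < m) `|f (lr i).2 - f (lr i).1| < e / 3.
  by apply: fd => //; apply: lt_le_trans lrd1 _; rewrite ge_min lexx.
have : k1 * \sum_(i < m) ((lr i).2 - (lr i).1) < e / 3.
  rewrite mulrC -ltr_pdivlMr//; apply: lt_le_trans lrd1 _.
  by rewrite ge_min lexx orbT.
have : e1 * (b - a) <= e / 3.
  by rewrite /e1 mulrAC ler_pdivrMr// ler_wpM2l//; lra.
move: fb; rewrite big_split/= -mulr_sumr; lra.
Qed.

(** * Boundedness and transfer of absolute continuity *)

(** With tolerance 1, the norm grows by at most 1 over a step shorter than [d], and finitely many
    steps of length [d / 2] cover [[a, b]]. *)
Lemma absolutely_continuous_on_bounded (R : realType) (V : normedModType R)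
    (a b : R) (f : R -> V) : absolutely_continuous_on a b f ->
  exists M : R, forall t : R, a <= t <= b -> `|f t| <= M.
Proof.
move=> /(_ 1 ltr01)[d d0 fd].
have step (l r : R) : a <= l -> l < r -> r <= b -> r - l < d ->
    `|f r| <= `|f l| + 1.
  move=> al lr rb rld.
  have := fd 1%N (fun=> l) (fun=> r); rewrite !big_ord1 => frl.
  rewrite -[f r](subrK (f l)) addrC (le_trans (ler_normD _ _))// lerD2l ltW//.
  by apply: frl => // i j _ _ _; rewrite !ord1.
have d20 : 0 < d / 2 by lra.
have bd (n : nat) (t : R) : a <= t <= b -> t <= a + n%:R * (d / 2) ->
    `|f t| <= `|f a| + n%:R.
  elim: n t => [|n IHn] t atb.
    by rewrite mul0r addr0 => ta; rewrite (_ : t = a) ?addr0//; lra.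
  rewrite -natr1 mulrDl mul1r => tn.
  have [tn'|tn'] := leP t (a + n%:R * (d / 2)).
    by have := IHn _ atb tn'; lra.
  have n0 : 0 <= n%:R * (d / 2) by rewrite mulr_ge0// ltW.
  have : `|f (a + n%:R * (d / 2))| <= `|f a| + n%:R by apply: IHn; lra.
  have : `|f t| <= `|f (a + n%:R * (d / 2))| + 1 by apply: step; lra.
  lra.
exists (`|f a| + (Num.truncn ((b - a) / (d / 2))).+1%:R) => t atb.
apply: bd => //.
have : (b - a) / (d / 2) < (Num.truncn ((b - a) / (d / 2))).+1%:R.
  exact: truncnS_gt.
rewrite ltr_pdivrMr//; lra.
Qed.

Lemma absolutely_continuous_on_dominated (R : realType) (V W : normedModType R)
    (a b K : R) (f : R -> V) (g : R -> W) :
  (forall l r : R, a <= l -> l < r -> r <= b ->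
    `|g r - g l| <= K * `|f r - f l|) ->
  absolutely_continuous_on a b f -> absolutely_continuous_on a b g.
Proof.
move=> gf fac e e0; have K10 : 0 < `|K| + 1 by rewrite ltr_wpDl.
have [|d d0 fd] := fac (e / (`|K| + 1)); first by rewrite divr_gt0.
exists d => // m l r lr triv lrd.
have := fd m l r lr triv lrd; rewrite ltr_pdivlMr//; apply: le_lt_trans.
rewrite mulr_suml; apply: ler_sum => i _; have [al [lri rb]] := lr i.
rewrite (le_trans (gf _ _ al lri rb))// mulrC ler_wpM2l//.
by rewrite ler_wpDr// ler_norm.
Qed.

(** * Derivatives almost everywhere and decay to zero *)

(** A zero with nonzero derivative is isolated in the zero set, and the isolated points of a set of
    reals are countable. *)
Lemma ae_zero_is_derive (R : realType) (y : R -> R) :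
  {ae lebesgue_measure, forall t : R, forall v : R,
    y t = 0 -> is_derive t 1 y v -> v = 0}.
Proof.
pose Z := [set t : R | y t = 0].
have cZ : countable (isolated Z) by exact: countable_isolated.
exists (isolated Z); split.
- exact: countable_measurable.
- exact: countable_lebesgue_measure0.
move=> t /= /existsNP[v]; rewrite not_implyE => -[yt0].
rewrite not_implyE => -[/is_derive1_caratheodory[q [yq cq qt]] /eqP v0].
split; first by rewrite inE.
have qv : q z @[z --> t] --> v by rewrite -qt; exact: cq.
(* On this neighbourhood [y z = q z * (z - t)] vanishes only at [t]. *)
exists [set z | q z != 0].
  exact: (cvgr_neq0 _ qv v0).
apply/seteqP; split => [z [/= qz yz]|z ->]; last by split => //=; rewrite qt.
have /eqP := yq z; rewrite yz yt0 subrr eq_sym mulf_eq0 (negbTE qz)/= subr_eq0.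
by move/eqP.
Qed.

(** The hypothesis removes the corner of the absolute value: at a zero the slope of [y] is 0, so the
    slopes of its absolute value on both sides agree. *)
Lemma is_derive_norm (R : realType) (y : R -> R) (t v : R) :
  (y t = 0 -> v = 0) -> is_derive t 1 y v ->
  is_derive t 1 (fun s => `|y s|) (Num.sg (y t) * v).
Proof.
move=> y0 dy.
have cy : y z @[z --> t] --> y t.
  apply/differentiable_continuous/derivable1_diffP.
  exact: ex_derive.
have [yt|yt|yt] := ltgtP (y t) 0.
- rewrite ltr0_sg// mulN1r.
  have : is_derive t 1 (- y) (- v) by exact: is_deriveN.
  apply: near_eq_is_derive.
  near=> z; have yz : y z < 0 by near: z; exact: (cvgr_lt _ cy).
  by rewrite ltr0_norm.
- rewrite gtr0_sg// mul1r.
  move: dy; apply: near_eq_is_derive.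
  near=> z; have yz : 0 < y z by near: z; exact: (cvgr_gt _ cy).
  by rewrite gtr0_norm.
- rewrite yt sgr0 mul0r.
  move: dy => /is_derive1_caratheodory[q [yq cq qt]].
  apply/is_derive1_caratheodory.
  (* The difference quotient of the absolute value; the jump of the sign is harmless because [q]
     tends to 0. *)
  exists (fun z => `|q z| * Num.sg (z - t)); split.
  + move=> z; rewrite yt normr0 subr0 -mulrA -[_ * (z - t)]normrEsg.
    by rewrite -normrM -yq yt subr0.
  + apply/cvgrPdist_lt => e e0; rewrite subrr sgr0 mulr0.
    have qv : q z @[z --> t] --> 0 by rewrite -(y0 yt) -qt; exact: cq.
    near=> z; have qz : `|q z| < e by near: z; apply: cvgr0_norm_lt.
    rewrite sub0r normrN normrM normr_id normr_sg.
    by case: eqP => _; rewrite ?mulr1// mulr0.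
  + by rewrite subrr sgr0 mulr0.
Unshelve. all: by end_near. Qed.

Lemma is_derive_coord (R : realType) (m n : nat) (x : R -> 'M[R]_(m, n))
    (t : R) (v : 'M[R]_(m, n)) (i : 'I_m) (j : 'I_n) :
  is_derive t 1 x v -> is_derive t 1 (fun s => x s i j) (v i j).
Proof.
move=> [dx <-]; rewrite derive_mx// mxE; apply: DeriveDef => //.
by move: dx => /derivable_mxP; exact.
Qed.

(* As long as [g >= e], it decreases at rate at least [phi e], which is only
   possible up to time [g 0 / phi e]. *)
Lemma cvg0_ae_dissipation (R : realType) (g phi : R -> R) :
  (forall T : R, 0 < T -> absolutely_continuous_on 0 T g) ->
  (forall t : R, 0 <= t -> 0 <= g t) ->
  {homo phi : u v / u <= v} -> 0 <= phi 0 ->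
  (forall u : R, 0 < u -> 0 < phi u) ->
  {ae lebesgue_measure, forall t : R, 0 <= t ->
    exists2 v : R, v <= - phi (g t) & is_derive t 1 g v} ->
  g t @[t --> +oo] --> (0 : R).
Proof.
move=> gac g0 phi_homo phi0 phi_gt0 gae.
(* Monotonicity turns a lower bound on [g] at time [t] into one on all of [[0, t]], where the rate
   [phi e] then applies. *)
have g_ni (s t : R) : 0 <= s -> s <= t -> g t <= g s.
  move=> s0 st; have t10 : 0 < t + 1 by lra.
  have : g t - g s <= 0 * (t - s).
    apply: abs_cont_ae_derive_le => //.
      by apply: absolutely_continuous_on_sub (gac _ t10); lra.
    apply: negligibleS gae => u; apply: contra_not => gu sut.
    have [|v vu dv] := gu; first lra.
    exists v => //; rewrite (le_trans vu)// oppr_le0 (le_trans phi0)//.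
    by apply/phi_homo/g0; lra.
  lra.
apply/cvgrPdist_lt => e e0; near=> t.
have t0 : 0 < t by near: t; exact: nbhs_pinfty_gt.
rewrite sub0r normrN ger0_norm ?g0 ?ltW// ltNge; apply/negP => egt.
have : g t - g 0 <= - phi e * (t - 0).
  apply: abs_cont_ae_derive_le; [exact: ltW|exact: gac|].
  apply: negligibleS gae => u; apply: contra_not => gu sut.
  have [|v vu dv] := gu; first lra.
  exists v => //; rewrite (le_trans vu)// lerN2.
  by apply/phi_homo/(le_trans egt)/g_ni; lra.
have : g 0 / phi e < t by near: t; apply: nbhs_pinfty_gt; rewrite num_real.
have := g0 t (ltW t0).
rewrite ltr_pdivrMr ?phi_gt0//; lra.
Unshelve. all: by end_near. Qed.

(** * The energy along relay trajectories *)

(** A Lur'e-type Lyapunov function: a quadratic form plus [gamma] times the integral of the sign. In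
    its derivative the weight [a2] cancels the products of x1 and x2, and the weight [gamma] those
    of x1 and the sign of x2. *)
Definition relay_energy {R : realType} (gamma a2 : R) (x : 'cV[R]_2) : R :=
  x 0 0 ^+ 2 / 2 + a2 / 2 * x 1 0 ^+ 2 + gamma * `|x 1 0|.

Lemma ler_mx_entry_norm (R : realType) (m n : nat) (x : 'M[R]_(m, n))
    (i : 'I_m) (j : 'I_n) : `|x i j| <= `|x|.
Proof.
rewrite [leRHS]/Num.Def.normr/= mx_normrE.
exact: (le_bigmax _ (fun ij => `|x ij.1 ij.2|) (i, j)).
Qed.

(** Brings the three branches of the inclusion to one form with a relay output [u], fixed off the
    switching line; on the line, the sliding condition [v 1 0 = 0] will determine it. *)
Lemma relay_field_coord (R : realType) (kappa gamma a1 a2 : R)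
    (x v : 'cV[R]_2) :
  relay_filippov (plantA a1 a2) (plantB kappa gamma) (plantC R) x v ->
  exists u : R, [/\ (x 1 0 != 0 -> u = - Num.sg (x 1 0)),
    v 0 0 = - a2 * x 1 0 + gamma * u &
    v 1 0 = x 0 0 - a1 * x 1 0 + kappa * u].
Proof.
have lift1 : lift ord0 ord0 = 1 :> 'I_2 by exact/val_inj.
have coord (u : R) (w : 'cV[R]_2) :
    w = plantA a1 a2 *m x + u *: plantB kappa gamma ->
    w 0 0 = - a2 * x 1 0 + gamma * u /\
    w 1 0 = x 0 0 - a1 * x 1 0 + kappa * u.
  by move=> ->; rewrite !mxE !big_ord_recl !big_ord0 !mxE/= !lift1; split; ring.
have yE : (plantC R *m x) 0 0 = x 1 0.
  by rewrite !mxE !big_ord_recl !big_ord0 !mxE/= !lift1; ring.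
rewrite /relay_filippov yE; case: ltgtP => y0 /=.
- move=> vE; have [] := coord (-1) v; first by rewrite vE scaleN1r.
  by exists (-1); rewrite gtr0_sg.
- move=> vE; have [] := coord 1 v; first by rewrite vE scale1r.
  by exists 1; rewrite ltr0_sg// opprK.
- move=> [u _ vE]; have [] := coord u v; first by rewrite vE.
  by exists u; split => //; rewrite -y0 eqxx.
Qed.

Lemma relay_energy_is_derive (R : realType) (gamma a2 t : R)
    (x : R -> 'cV[R]_2) (v : 'cV[R]_2) :
  (x t 1 0 = 0 -> v 1 0 = 0) -> is_derive t 1 x v ->
  is_derive t 1 (relay_energy gamma a2 \o x)
    (x t 0 0 * v 0 0 + a2 * x t 1 0 * v 1 0 +
     gamma * (Num.sg (x t 1 0) * v 1 0)).
Proof.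
move=> v0 dx.
have dp := @is_derive_coord _ _ _ _ _ _ 0 0 dx.
have dy := @is_derive_coord _ _ _ _ _ _ 1 0 dx.
have dn := is_derive_norm _ _ _ _ v0 dy.
set p := fun s => x s 0 0 in dp; set y := fun s => x s 1 0 in dy dn.
have -> : relay_energy gamma a2 \o x =
    (1 / 2) *: (p * p) + (a2 / 2) *: (y * y) + gamma *: (fun s => `|y s|).
  apply/funext => s; rewrite /relay_energy/= !fctE /p /y /GRing.scale/=; ring.
by apply: is_derive_eq; rewrite /GRing.scale/= /p /y; field.
Qed.

Lemma relay_energy_dissipation (R : realType) (kappa gamma a1 a2 : R)
    (x v : 'cV[R]_2) : 0 < kappa -> 0 < gamma -> 0 < a1 -> 0 < a2 ->
  relay_filippov (plantA a1 a2) (plantB kappa gamma) (plantC R) x v ->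
  (x 1 0 = 0 -> v 1 0 = 0) ->
  x 0 0 * v 0 0 + a2 * x 1 0 * v 1 0 + gamma * (Num.sg (x 1 0) * v 1 0) <=
  - Num.min (gamma * kappa) (2 * gamma / kappa * relay_energy gamma a2 x).
Proof.
move=> k0 c0 a10 a20 /relay_field_coord[u [uE v0E v1E]] v10.
rewrite lerNr ge_min.
have [y0|y0] := eqVneq (x 1 0) 0.
  (* The equivalent control of the sliding mode. The energy is then half of [x 0 0 ^+ 2], so the
     bound by the second term of the minimum is an equality. *)
  have uk : u = - x 0 0 / kappa.
    apply: (mulfI (lt0r_neq0 k0)); rewrite mulrCA mulfV ?gt_eqF// mulr1.
    by move: v1E; rewrite v10// y0; lra.
  apply/orP; right; rewrite v0E v10// uk y0 /relay_energy y0 normr0 sgr0.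
  by rewrite le_eqVlt; apply/orP; left; apply/eqP; field; rewrite gt_eqF.
apply/orP; left; rewrite v0E v1E uE//.
have sy : x 1 0 = Num.sg (x 1 0) * `|x 1 0| by rewrite -numEsg.
have s2 : Num.sg (x 1 0) * Num.sg (x 1 0) = 1.
  by rewrite -expr2 sqr_sg y0.
set s := Num.sg (x 1 0) in sy s2 *; set n := `|x 1 0| in sy.
have n0 : 0 <= n by exact: normr_ge0.
(* After the cancellations all terms left are nonnegative, and [gamma * kappa * (s * s)] alone gives
   the constant rate. *)
have -> : - (x 0 0 * (- a2 * x 1 0 + gamma * - s) +
    a2 * x 1 0 * (x 0 0 - a1 * x 1 0 + kappa * - s) +
    gamma * (s * (x 0 0 - a1 * x 1 0 + kappa * - s))) =
    a1 * a2 * x 1 0 ^+ 2 + a2 * kappa * (x 1 0 * s) +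
    gamma * a1 * (x 1 0 * s) + gamma * kappa * (s * s) by ring.
have -> : x 1 0 * s = n by rewrite sy mulrAC s2 mul1r.
rewrite s2 mulr1 lerDr.
have := mulr_ge0 (ltW (mulr_gt0 a10 a20)) (sqr_ge0 (x 1 0)).
have := mulr_ge0 (ltW (mulr_gt0 a20 k0)) n0.
have := mulr_ge0 (ltW (mulr_gt0 c0 a10)) n0.
lra.
Qed.

Lemma relay_energy_ge0 (R : realType) (gamma a2 : R) (x : 'cV[R]_2) :
  0 <= gamma -> 0 <= a2 -> 0 <= relay_energy gamma a2 x.
Proof.
move=> c0 a20.
by rewrite !addr_ge0// ?(sqr_ge0, divr_ge0, mulr_ge0, ler0n, normr_ge0).
Qed.

Lemma absolutely_continuous_relay_energy (R : realType) (gamma a2 a b : R)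
    (x : R -> 'cV[R]_2) : 0 <= gamma -> 0 <= a2 ->
  absolutely_continuous_on a b x ->
  absolutely_continuous_on a b (relay_energy gamma a2 \o x).
Proof.
move=> c0 a20 xac.
have [M xM] := absolutely_continuous_on_bounded _ _ _ _ _ xac.
(* A Lipschitz constant of the energy on the ball of radius [M]: the two squares contribute [M] and
   [a2 * M], the absolute value [gamma]. *)
apply: (@absolutely_continuous_on_dominated _ _ _ _ _ (M + a2 * M + gamma)) xac.
move=> l r al lr rb /=; rewrite /relay_energy.
have sq (i : 'I_2) : `|x r i 0 ^+ 2 - x l i 0 ^+ 2| <= 2 * M * `|x r - x l|.
  rewrite subr_sqr normrM mulrC ler_pM//.
    rewrite (le_trans (ler_normD _ _))//.
    have := le_trans (ler_mx_entry_norm _ _ _ (x r) i 0) (xM r _).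
    have := le_trans (ler_mx_entry_norm _ _ _ (x l) i 0) (xM l _).
    by move=> /(_ ltac:(lra)) ? /(_ ltac:(lra)) ?; lra.
  by have := ler_mx_entry_norm _ _ _ (x r - x l) i 0; rewrite !mxE.
have nn : `| `|x r 1 0| - `|x l 1 0| | <= `|x r - x l|.
  rewrite (le_trans (ler_dist_dist _ _))//.
  by have := ler_mx_entry_norm _ _ _ (x r - x l) 1 0; rewrite !mxE.
set d := `|x r - x l| in sq nn *.
have -> : forall p p' q q' n n' : R, p ^+ 2 / 2 + a2 / 2 * q ^+ 2 + gamma * n -
    (p' ^+ 2 / 2 + a2 / 2 * q' ^+ 2 + gamma * n') =
    (p ^+ 2 - p' ^+ 2) / 2 + a2 / 2 * (q ^+ 2 - q' ^+ 2) + gamma * (n - n').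
  by move=> *; field.
rewrite !(le_trans (ler_normD _ _))//.
have -> : (M + a2 * M + gamma) * d =
   2 * M * d / 2 + a2 / 2 * (2 * M * d) + gamma * d by field.
rewrite lerD//; last by rewrite normrM (ger0_norm c0) ler_wpM2l.
rewrite (le_trans (ler_normD _ _))// lerD//.
  by rewrite normrM normfV normr_nat ler_pM2r.
by rewrite normrM [X in X * _]ger0_norm ?ler_wpM2l// divr_ge0.
Qed.

Lemma relay_energy_cvg0 (R : realType) (kappa gamma a1 a2 : R)
    (x : R -> 'cV[R]_2) : 0 < kappa -> 0 < gamma -> 0 < a1 -> 0 < a2 ->
  relay_trajectory (plantA a1 a2) (plantB kappa gamma) (plantC R) x ->
  relay_energy gamma a2 (x t) @[t --> +oo] --> (0 : R).
Proof.
move=> k0 c0 a10 a20 [xac xae].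
have c20 : 0 < 2 * gamma / kappa by rewrite divr_gt0// mulr_gt0.
pose phi u := Num.min (gamma * kappa) (2 * gamma / kappa * u).
apply: (@cvg0_ae_dissipation _ (relay_energy gamma a2 \o x) phi).
- move=> T T0.
  by apply: absolutely_continuous_relay_energy; [lra|lra|exact: xac].
- by move=> t _; apply: relay_energy_ge0; lra.
- by move=> u v uv; rewrite /phi le_min !ge_min lexx/= ler_pM2l// uv orbT.
- by rewrite /phi mulr0 le_min lexx andbT mulr_ge0 ?ltW.
- by move=> u u0; rewrite /phi lt_min (mulr_gt0 c0 k0) (mulr_gt0 c20 u0).
(* Two null sets are discarded: the times where the inclusion fails and the transversal zeros of the
   output. *)
have := negligibleU xae (ae_zero_is_derive R (fun t => x t 1 0)).
apply: negligibleS; rewrite -setCI; apply: subsetC => t [/= xt yt] t0.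
have [v Fv dx] := xt t0.
have v0 : x t 1 0 = 0 -> v 1 0 = 0.
  by move=> /yt; apply; exact: is_derive_coord.
exists (x t 0 0 * v 0 0 + a2 * x t 1 0 * v 1 0 +
  gamma * (Num.sg (x t 1 0) * v 1 0)); last exact: relay_energy_is_derive.
exact: relay_energy_dissipation Fv v0.
Qed.

(** * The chattering set and the conclusion *)

(** The origin belongs to the set, so the Euclidean norm of [x] bounds the distance. In the
    constant, [2] recovers the square of x1 from the energy and [2 / a2] that of x2; what remains is
    nonnegative. *)
Lemma distance_to_chattering_le (R : realType) (kappa gamma a2 : R)
    (x : 'cV[R]_2) : 0 <= kappa -> 0 <= gamma -> 0 < a2 ->
  0 <= distance_to (chattering_set kappa) x <=
  Num.sqrt ((2 + 2 / a2) * relay_energy gamma a2 x).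
Proof.
move=> k0 c0 a20.
have S0 : chattering_set kappa 0.
  by rewrite /chattering_set/= !mxE oppr_le0 k0.
have lb : lbound [set euclidean_norm (x - y) | y in chattering_set kappa] 0.
  by move=> _ [y _ <-]; exact: sqrtr_ge0.
apply/andP; split; first by apply: lb_le_inf => //;
  exists (euclidean_norm (x - 0)), 0.
apply: (@le_trans _ _ (euclidean_norm (x - 0))).
  by apply: ge_inf; [exists 0|exists 0].
rewrite subr0 /euclidean_norm ler_sqrt; last first.
  by rewrite mulr_ge0 ?relay_energy_ge0 ?addr_ge0 ?divr_ge0// ltW.
rewrite !big_ord_recl big_ord0 addr0.
have -> : lift ord0 ord0 = 1 :> 'I_2 by exact/val_inj.
rewrite /relay_energy; set p := x 0 0 ^+ 2; set q := x 1 0 ^+ 2.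
have p0 : 0 <= p by exact: sqr_ge0.
have q0 : 0 <= q by exact: sqr_ge0.
have n0 : 0 <= gamma * `|x 1 0| by rewrite mulr_ge0.
have -> : (2 + 2 / a2) * (p / 2 + a2 / 2 * q + gamma * `|x 1 0|) =
    p + q + (p / a2 + a2 * q + (2 + 2 / a2) * (gamma * `|x 1 0|)).
  by field; rewrite gt_eqF.
rewrite lerDl !addr_ge0//; [|exact/mulr_ge0/q0/ltW|].
- by rewrite divr_ge0// ltW.
- by rewrite mulr_ge0// addr_ge0// divr_ge0// ltW.
Qed.

Lemma chattering_set_bounded (R : realType) (kappa : R) :
  bounded_set (chattering_set kappa).
Proof.
exists `|kappa|; split; first exact: num_real.
move=> M kM x [xk x0] /=; rewrite [leLHS]/Num.Def.normr/= mx_normrE.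
have M0 : 0 <= M by exact: le_trans (ltW kM).
apply: bigmax_le => //= -[i j] _ /=; rewrite ord1.
have [->|[k ->]] : i = 0 \/ exists k, i = lift 0 k.
- by case: (unliftP 0 i) => [k ->|->]; [right; exists k|left].
- apply: le_trans (ltW kM); rewrite ler_norml.
  by have := ler_norm kappa; lra.
- by rewrite ord1 (_ : lift 0 0 = 1) ?x0 ?normr0//; exact/val_inj.
Qed.

Lemma chattering_set_null (R : realType) (kappa : R) :
  null_set2 (chattering_set kappa).
Proof.
exists ([set` `[- kappa, kappa]%R] `*` [set 0]); split.
- by apply: measurableX; [exact: measurable_itv|exact: measurable_set1].
- rewrite product_measure1E//.
  by rewrite [X in (_ * X)%E]lebesgue_measure_set1 mule0.
- move=> [p q] /=; rewrite /chattering_set/= !mxE/= => -[pk ->].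
  by split => //=; rewrite in_itv.
Qed.

Theorem mainTheorem3 (R : realType) (kappa gamma a1 a2 : R)
    (hkappa : 0 < kappa) (hgamma : 0 < gamma) (ha1 : 0 < a1) (ha2 : 0 < a2) :
  (forall x : R -> 'cV[R]_2,
     relay_trajectory (plantA a1 a2) (plantB kappa gamma) (plantC R) x ->
     distance_to (chattering_set kappa) (x t) @[t --> +oo] --> (0 : R)) /\
  bounded_set (chattering_set kappa) /\
  null_set2 (chattering_set kappa).
Proof.
split; last first.
  by split; [exact: chattering_set_bounded|exact: chattering_set_null].
move=> x /(relay_energy_cvg0 _ _ _ _ _ _ hkappa hgamma ha1 ha2) x0.
apply: (@squeeze_cvgr _ _ _ _ (fun=> 0)
  (fun t => Num.sqrt ((2 + 2 / a2) * relay_energy gamma a2 (x t)))).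
- by near=> t; apply: distance_to_chattering_le => //; exact: ltW.
- exact: cvg_cst.
have : (2 + 2 / a2) * relay_energy gamma a2 (x t) @[t --> +oo] --> (0 : R).
  by rewrite -(mulr0 (2 + 2 / a2)); exact: cvgMr.
move=> /(continuous_cvg _ (@sqrt_continuous R 0)).
by rewrite sqrtr0.
Unshelve. all: by end_near. Qed.
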